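(* Let $\mathbf{e}$ be a transitive relation on a finite set $E$. The following are equivalent: (i) $\mathrm{Reg}(\mathbf{e})$ is a bounded homomorphic image of a free lattice; (ii) $\mathrm{Reg}(\mathbf{e})$ is semidistributive; (iii) $\mathrm{Reg}(\mathbf{e})$ is pseudocomplemented; (iv) every connected component $C$ of the preordering $\unlhd$ is such that either the restriction of $\mathbf{e}$ to $C$ is antisymmetric, or $C=\{a,b\}$ with $a\neq b$, $(a,b)\in\mathbf{e}$ and $(b,a)\in\mathbf{e}$.
   Context: $\mathbf{e}$ is viewed as a set of ordered pairs; $x\unlhd y$ means $(x,y)\in\mathbf{e}$ or $x=y$ (a preordering); its connected components are those of the undirected graph on $E$ joining $x,y$ whenever $x\unlhd y$. Antisymmetric: $(x,y),(y,x)\in\mathbf{e}$ imply $x=y$. A subset $\mathbf{a}\subseteq\mathbf{e}$ is closed if transitive, open if $\mathbf{e}\setminus\mathbf{a}$ is transitive; $\mathrm{cl}$ is transitive closure, $\mathrm{int}(\mathbf{a})$ the largest open subset; regular closed means $\mathbf{a}=\mathrm{cl}(\mathrm{int}(\mathbf{a}))$. $\mathrm{Reg}(\mathbf{e})$ is the lattice of regular closed subsets under inclusion (join $\mathrm{cl}(\bigcup)$, meet $\mathrm{cl}(\mathrm{int}(\bigcap))$). A lattice $L$ is a bounded homomorphic image of a free lattice if there is a free lattice $F$ and a surjective lattice homomorphism $f:F\to L$ such that each $f^{-1}\{x\}$ has a least and a largest element. $L$ is join-semidistributive if $x\vee z=y\vee z$ implies $x\vee z=(x\wedge y)\vee z$,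 meet-semidistributive dually, and semidistributive if both. $L$ with least element $0$ is pseudocomplemented if each $\{y: x\wedge y=0\}$ has a greatest element. *)

(* Defs.v *)
From HB Require Import structures.
From mathcomp Require Import all_boot all_order.

Set Implicit Arguments.
Unset Strict Implicit.
Unset Printing Implicit Defensive.

Import Order.TTheory.
Local Open Scope order_scope.

Section TransitiveRelations.
Variable E : finType.
Implicit Types a b e : {set E * E}.

Definition set_transitive a : bool :=
  [forall x, forall y, forall z,
     ((x, y) \in a) ==> ((y, z) \in a) ==> ((x, z) \in a)].

Lemma set_transitiveP a :
  reflect (transitive [rel x y | (x, y) \in a]) (set_transitive a).
Proof.
apply: (iffP forallP) => [h y x z /= xy yz | h x].
  by move/forallP: (h x) => /(_ y)/forallP/(_ z)/implyP/(_ xy)/implyP/(_ yz).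
apply/forallP=> y; apply/forallP=> z; apply/implyP=> xy; apply/implyP=> yz.
exact: h xy yz.
Qed.

Definition cl a : {set E * E} :=
  \bigcap_(b : {set E * E} | set_transitive b && (a \subset b)) b.

Definition is_open e a : bool := (a \subset e) && set_transitive (e :\: a).

Definition interior e a : {set E * E} :=
  \bigcup_(b : {set E * E} | is_open e b && (b \subset a)) b.

Definition regular_closed e a : bool :=
  (a \subset e) && (a == cl (interior e a)).

Lemma sub_cl a : a \subset cl a.
Proof. by apply/bigcapsP=> b /andP[]. Qed.

Lemma cl_sub a b : set_transitive b -> a \subset b -> cl a \subset b.
Proof. by move=> tb ab; apply: bigcap_inf; rewrite tb. Qed.

Lemma cl_transitive a : set_transitive (cl a).
Proof.
apply/set_transitiveP => y x z /= /bigcapP xy /bigcapP yz.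
apply/bigcapP => b hb; have /andP[/set_transitiveP tb _] := hb.
by apply: (tb y); [apply: xy | apply: yz].
Qed.

Lemma clS a b : a \subset b -> cl a \subset cl b.
Proof.
by move=> ab; rewrite cl_sub ?cl_transitive // (subset_trans ab) ?sub_cl.
Qed.

Lemma cl_id a : set_transitive a -> cl a = a.
Proof. by move=> ta; apply/eqP; rewrite eqEsubset sub_cl cl_sub. Qed.

Lemma int_sub e a : interior e a \subset a.
Proof. by apply/bigcupsP=> b /andP[]. Qed.

Lemma sub_int e a b : is_open e b -> b \subset a -> b \subset interior e a.
Proof. by move=> ob ba; apply: bigcup_sup; rewrite ob. Qed.

Lemma int_open e a : set_transitive e -> is_open e (interior e a).
Proof.
move=> /set_transitiveP te; apply/andP; split.
  by apply/bigcupsP=> b /andP[/andP[]].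
apply/set_transitiveP => y x z /=; rewrite !in_setD.
move=> /andP[xyN xye] /andP[yzN yze]; have {te} xze : (x, z) \in e := te y x z xye yze.
rewrite xze andbT.
apply/bigcupP => -[b hb xzb].
have /andP[/andP[_ /set_transitiveP tb] _] := hb.
have xyb : (x, y) \notin b by apply: contra xyN => xyb; apply/bigcupP; exists b.
have yzb : (y, z) \notin b by apply: contra yzN => yzb; apply/bigcupP; exists b.
by have /(_ y x z) /= := tb; rewrite !in_setD xyb yzb xye yze xzb; move/(_ isT isT).
Qed.

Lemma intS e a b : set_transitive e -> a \subset b -> interior e a \subset interior e b.
Proof.
by move=> te ab; rewrite sub_int ?int_open // (subset_trans _ ab) ?int_sub.
Qed.

Lemma int_id e a : is_open e a -> interior e a = a.
Proof. by move=> oa; apply/eqP; rewrite eqEsubset int_sub sub_int. Qed.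

Lemma regular_closed_trans e a : regular_closed e a -> set_transitive a.
Proof. by case/andP=> _ /eqP->; apply: cl_transitive. Qed.

Lemma cl_int_regular e a : set_transitive e -> regular_closed e (cl (interior e a)).
Proof.
move=> te; apply/andP; split.
  by rewrite cl_sub //; case/andP: (int_open a te).
rewrite eqEsubset clS ?sub_int ?int_open ?sub_cl //=.
by rewrite cl_sub ?cl_transitive ?int_sub.
Qed.

Lemma clU_regular e a b : set_transitive e ->
  regular_closed e a -> regular_closed e b -> regular_closed e (cl (a :|: b)).
Proof.
move=> te /andP[ae /eqP ea] /andP[be /eqP eb]; apply/andP; split.
  by rewrite cl_sub // subUset ae.
rewrite eqEsubset; apply/andP; split; apply: cl_sub; rewrite ?cl_transitive //.
  rewrite subUset; apply/andP; split.
    rewrite {1}ea; apply/clS/intS => //.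
    by rewrite (subset_trans _ (sub_cl _)) ?subsetUl.
  rewrite {1}eb; apply/clS/intS => //.
  by rewrite (subset_trans _ (sub_cl _)) ?subsetUr.
exact: int_sub.
Qed.

Lemma regular0 e : set_transitive e -> regular_closed e set0.
Proof.
move=> te; apply/andP; split; first exact: sub0set.
have -> : interior e set0 = set0 by apply/eqP; rewrite -subset0 int_sub.
rewrite cl_id //; apply/set_transitiveP => y x z /=; by rewrite inE.
Qed.

Lemma regularT e : set_transitive e -> regular_closed e e.
Proof.
move=> te; have oe : is_open e e.
  rewrite /is_open subxx setDv; apply/set_transitiveP => y x z /=.
  by rewrite inE.
by rewrite /regular_closed subxx (int_id oe) cl_id /=.
Qed.

Definition trile e : rel E := [rel x y | ((x, y) \in e) || (x == y)].

Definition component e (x : E) : {set E} :=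
  [set y | connect [rel u v | trile e u v || trile e v u] x y].

Definition components e : {set {set E}} := [set component e x | x : E].

Definition restriction e (C : {set E}) : {set E * E} := e :&: setX C C.

Definition set_antisymmetric a : Prop :=
  forall x y, (x, y) \in a -> (y, x) \in a -> x = y.

End TransitiveRelations.

(* The transitivity proof is a parameter of the type because the lattice
   structure depends on it: without it, cl (a :|: b) need not be included in e. *)
Definition Reg (E : finType) (e : {set E * E}) (te : set_transitive e) : Type :=
  {a : {set E * E} | regular_closed e a}.

Fact reg_display : Order.disp_t. Proof. exact: Order.Disp tt tt. Qed.

Section RegLattice.
Variables (E : finType) (e : {set E * E}) (te : set_transitive e).

HB.instance Definition _ :=
  Finite.copy (Reg te) {a : {set E * E} | regular_closed e a}.

Implicit Types a b c : Reg te.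

Definition reg_le a b := val a \subset val b.
Definition reg_join a b : Reg te :=
  Sub (cl (val a :|: val b)) (clU_regular te (valP a) (valP b)).
Definition reg_meet a b : Reg te :=
  Sub (cl (interior e (val a :&: val b))) (cl_int_regular (val a :&: val b) te).
Definition reg_bot : Reg te := Sub set0 (regular0 te).
Definition reg_top : Reg te := Sub e (regularT te).

Fact reg_le_refl : reflexive reg_le.
Proof. by move=> a; apply: subxx. Qed.

Fact reg_le_anti : antisymmetric reg_le.
Proof. by move=> a b ab; apply/val_inj/eqP; rewrite eqEsubset. Qed.

Fact reg_le_trans : transitive reg_le.
Proof. by move=> b a c; apply: subset_trans. Qed.

HB.instance Definition _ := Order.Le_isPOrder.Build reg_display (Reg te)
  reg_le_refl reg_le_anti reg_le_trans.

Fact reg_meetP a b c : (a <= reg_meet b c) = (a <= b) && (a <= c).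
Proof.
rewrite /Order.le /= /reg_le -subsetI.
apply/idP/idP => [h | h].
  apply: subset_trans h _; rewrite subsetI.
  have [tb tc] := (regular_closed_trans (valP b), regular_closed_trans (valP c)).
  by rewrite !cl_sub // (subset_trans (int_sub _ _)) ?subsetIl ?subsetIr.
by case/andP: (valP a) => _ /eqP {1}->; apply/clS/intS.
Qed.

Fact reg_joinP a b c : (reg_join a b <= c) = (a <= c) && (b <= c).
Proof.
rewrite /Order.le /= /reg_le -subUset.
apply/idP/idP => [|h]; first exact/subset_trans/sub_cl.
exact: cl_sub (regular_closed_trans (valP c)) h.
Qed.

HB.instance Definition _ :=
  Order.POrder_MeetJoin_isLattice.Build reg_display (Reg te)
    reg_meetP reg_joinP.

Fact reg_le0x a : reg_bot <= a. Proof. exact: sub0set. Qed.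
Fact reg_lex1 a : a <= reg_top. Proof. by case/andP: (valP a). Qed.

HB.instance Definition _ :=
  Order.hasBottom.Build reg_display (Reg te) reg_le0x.
HB.instance Definition _ :=
  Order.hasTop.Build reg_display (Reg te) reg_lex1.

End RegLattice.

Section LatticeNotions.

Definition is_least (d : Order.disp_t) (T : porderType d) (P : T -> Prop)
  (m : T) : Prop := P m /\ forall x, P x -> m <= x.

Definition is_greatest (d : Order.disp_t) (T : porderType d) (P : T -> Prop)
  (m : T) : Prop := P m /\ forall x, P x -> x <= m.

Definition free_lattice (X : Type) (d : Order.disp_t) (F : latticeType d)
    (i : X -> F) : Prop :=
  forall (d' : Order.disp_t) (L : latticeType d') (g : X -> L),
  exists h : {lmorphism F -> L},
    h \o i =1 g /\
    forall h' : {lmorphism F -> L}, h' \o i =1 g -> h' =1 h.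

Definition bounded_image_of_free (d : Order.disp_t) (L : latticeType d) : Prop :=
  exists (X : Type) (d' : Order.disp_t) (F : latticeType d') (i : X -> F),
    free_lattice i /\
    exists f : {lmorphism F -> L},
      (forall y : L, exists x : F, f x = y) /\
      (forall y : L,
        (exists m, is_least (fun x : F => f x = y) m) /\
        (exists m, is_greatest (fun x : F => f x = y) m)).

Definition join_semidistributive (d : Order.disp_t) (L : latticeType d) : Prop :=
  forall x y z : L, x `|` z = y `|` z -> x `|` z = (x `&` y) `|` z.

Definition meet_semidistributive (d : Order.disp_t) (L : latticeType d) : Prop :=
  forall x y z : L, x `&` z = y `&` z -> x `&` z = (x `|` y) `&` z.

Definition semidistributive (d : Order.disp_t) (L : latticeType d) : Prop :=
  join_semidistributive L /\ meet_semidistributive L.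

Definition pseudocomplemented (d : Order.disp_t) (L : bLatticeType d) : Prop :=
  forall x : L, exists m, is_greatest (fun y : L => x `&` y = \bot) m.

End LatticeNotions.

(* Main.v *)
Require Import Defs.
From HB Require Import structures.
From mathcomp Require Import all_boot all_order.
From mathcomp Require Import boolp.

(** A free lattice satisfies Whitman's condition (by Day's interval doubling and
    the universal property), so minimal join representations refine all others
    and the lattice is semidistributive; least and greatest elements of the
    fibers transfer this to bounded images. In a finite meet-semidistributive
    lattice the join of all elements disjoint from [x] is disjoint from [x].

    The sets of pairs [(x, y)] in [e] with [a <| x], [y <| b], [x = a] or [x]
    outside [U], and [y = b] or [y] in [U], are clopen. If [x] and [y] are
    equivalent and [z] is a third element comparable to them, three such sets
    violate pseudocomplementation. Under the condition on components, the same
    sets are join-dense and a nontrivial join cover of the one given by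
    [(a, b, U)] refines to sets given by smaller intervals, so the morphism from
    the free lattice on [Reg e] has least fiber elements, computed by recursion
    on the size of [[a, b]]; the orthocomplement [cl (e \ a)] gives the greatest
    ones. *)

Set Implicit Arguments.
Unset Strict Implicit.
Unset Printing Implicit Defensive.

Import Order.TTheory.
Local Open Scope order_scope.

(** * Lattice terms and generated lattices *)

Inductive term (X : Type) : Type :=
| Var of X
| Meet of term X & term X
| Join of term X & term X.

Fixpoint eval (X : Type) (d : Order.disp_t) (L : latticeType d) (g : X -> L)
    (t : term X) : L :=
  match t with
  | Var x => g x
  | Meet t1 t2 => eval g t1 `&` eval g t2
  | Join t1 t2 => eval g t1 `|` eval g t2
  end.

Fixpoint term_size (X : Type) (t : term X) : nat :=
  match t with
  | Var _ => 1
  | Meet t1 t2 | Join t1 t2 => (term_size t1 + term_size t2).+1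
  end.

Definition generates (X : Type) (d : Order.disp_t) (L : latticeType d)
    (g : X -> L) : Prop := forall y : L, exists t, eval g t = y.

Lemma morph_eval (X : Type) (d d' : Order.disp_t) (L : latticeType d)
    (L' : latticeType d') (f : {lmorphism L -> L'}) (g : X -> L) (t : term X) :
  f (eval g t) = eval (f \o g) t.
Proof. by elim: t => //= t1 <- t2 <-; rewrite ?omorphI ?omorphU. Qed.

Fixpoint dual_term (X : Type) (t : term X) : term X :=
  match t with
  | Var x => Var x
  | Meet t1 t2 => Join (dual_term t1) (dual_term t2)
  | Join t1 t2 => Meet (dual_term t1) (dual_term t2)
  end.

(** The dual lattice has the same carrier and generators, so each join-sided result about generated
    lattices yields its meet-sided version. *)
Lemma generates_dual (X : Type) (d : Order.disp_t) (L : latticeType d)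
    (g : X -> L) : generates g -> generates (g : X -> L^d).
Proof.
move=> gen y; have [t <-] := gen y; exists (dual_term t).
by elim: t => //= t1 -> t2 ->.
Qed.

Section LatticeMorphismOf.
Variables (d d' : Order.disp_t) (L : latticeType d) (L' : latticeType d').
Variable f : L -> L'.
Hypotheses (fI : {morph f : x y / x `&` y}) (fU : {morph f : x y / x `|` y}).

Let f_homo : {homo f : x y / x <= y}.
Proof. by move=> x y /meet_idPl xy; rewrite -xy fI leIr. Qed.

Definition lmorphism_of : {lmorphism L -> L'} :=
  HB.pack f (Order.isOrderMorphism.Build _ _ _ _ f f_homo)
    (Order.isMeetLatticeMorphism.Build _ _ _ _ f fI)
    (Order.isJoinLatticeMorphism.Build _ _ _ _ f fU).

End LatticeMorphismOf.

(** * Free lattices *)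

Section TermChoice.
Variable X : choiceType.

(** The encoding into generic trees gives terms a choice structure, from which [canon] picks
    representatives. *)
Fixpoint tree_of_term (t : term X) : GenTree.tree X :=
  match t with
  | Var x => GenTree.Leaf x
  | Meet t1 t2 => GenTree.Node 0 [:: tree_of_term t1; tree_of_term t2]
  | Join t1 t2 => GenTree.Node 1 [:: tree_of_term t1; tree_of_term t2]
  end.

Fixpoint term_of_tree (t : GenTree.tree X) : option (term X) :=
  match t with
  | GenTree.Leaf x => Some (Var x)
  | GenTree.Node n [:: t1; t2] =>
      match term_of_tree t1, term_of_tree t2 with
      | Some s1, Some s2 => Some (if n == 0 then Meet s1 s2 else Join s1 s2)
      | _, _ => None
      end
  | _ => None
  end.

Lemma tree_of_termK : pcancel tree_of_term term_of_tree.
Proof. by elim=> //= t1 -> t2 ->. Qed.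

HB.instance Definition _ := Choice.copy (term X) (pcan_type tree_of_termK).

End TermChoice.

Section FreeLattice.
Variable X : choiceType.
Implicit Types s t : term X.

(** A semantic order instead of a syntactic deduction system: the lattice laws are inherited from
    arbitrary lattices, and evaluation respects the induced equivalence by construction. *)
Definition term_le t s : bool :=
  `[< forall (d : Order.disp_t) (L : latticeType d) (g : X -> L),
        eval g t <= eval g s >].

Definition term_eqv t s := term_le t s && term_le s t.

Lemma term_le_refl : reflexive term_le.
Proof. by move=> t; apply/asboolP. Qed.

Lemma term_le_trans : transitive term_le.
Proof.
move=> s t r /asboolP ts /asboolP sr; apply/asboolP => d L g.
exact: le_trans (ts d L g) (sr d L g).
Qed.

Definition canon t := choose (term_eqv t) t.

Lemma canon_eqv t : term_eqv t (canon t).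
Proof. by apply: chooseP; rewrite /term_eqv term_le_refl. Qed.

Lemma eq_canon t s : term_eqv t s -> canon t = canon s.
Proof.
move=> /andP[ts st]; rewrite /canon.
have eq_ts : term_eqv t =1 term_eqv s.
  move=> r; rewrite /term_eqv; apply/andP/andP => -[r1 r2]; split.
  - exact: term_le_trans r1.
  - exact: term_le_trans ts.
  - exact: term_le_trans r1.
  - exact: term_le_trans st.
rewrite (eq_choose eq_ts); apply: choose_id => //.
  by rewrite /term_eqv ts st.
by rewrite /term_eqv term_le_refl.
Qed.

Definition is_canon t : bool := canon t == t.

Lemma canonK t : is_canon (canon t).
Proof. by apply/eqP/esym/eq_canon/canon_eqv. Qed.

(** The quotient by [term_eqv], realised as the subtype of chosen representatives. *)
Definition free : Type := {t : term X | is_canon t}.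

HB.instance Definition _ := SubChoice.copy free {t : term X | is_canon t}.

Definition free_class t : free := Sub (canon t) (canonK t).
Definition free_le (a b : free) := term_le (val a) (val b).
Definition free_meet (a b : free) := free_class (Meet (val a) (val b)).
Definition free_join (a b : free) := free_class (Join (val a) (val b)).

Fact free_le_refl : reflexive free_le.
Proof. by move=> a; apply: term_le_refl. Qed.

Fact free_le_anti : antisymmetric free_le.
Proof.
move=> a b ab; apply: val_inj.
by rewrite -(eqP (valP a)) -(eqP (valP b)); apply: eq_canon.
Qed.

Fact free_le_trans : transitive free_le.
Proof. by move=> b a c; apply: term_le_trans. Qed.

Fact free_display : Order.disp_t. Proof. exact: Order.Disp tt tt. Qed.

HB.instance Definition _ := Order.Le_isPOrder.Build free_display free
  free_le_refl free_le_anti free_le_trans.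

Fact free_meetP a b c : (a <= free_meet b c) = (a <= b) && (a <= c).
Proof.
rewrite /Order.le /= /free_le /free_meet SubK.
have /andP[le1 le2] := canon_eqv (Meet (val b) (val c)).
apply/idP/andP => [abc|[/asboolP ab /asboolP ac]].
  have {abc}/asboolP abc := term_le_trans abc le2.
  by split; apply/asboolP => d L g; have := abc d L g; rewrite lexI => /andP[].
apply: term_le_trans le1; apply/asboolP => d L g /=.
by rewrite lexI ab ac.
Qed.

Fact free_joinP a b c : (free_join a b <= c) = (a <= c) && (b <= c).
Proof.
rewrite /Order.le /= /free_le /free_join SubK.
have /andP[le1 le2] := canon_eqv (Join (val a) (val b)).
apply/idP/andP => [abc|[/asboolP ab /asboolP ac]].
  have {abc}/asboolP abc := term_le_trans le1 abc.
  by split; apply/asboolP => d L g; have := abc d L g; rewrite leUx => /andP[].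
apply: (term_le_trans le2); apply/asboolP => d L g /=.
by rewrite leUx ab ac.
Qed.

HB.instance Definition _ :=
  Order.POrder_MeetJoin_isLattice.Build free_display free
    free_meetP free_joinP.

Definition free_var (x : X) : free := free_class (Var x).

Lemma eval_canon (d : Order.disp_t) (L : latticeType d) (g : X -> L) t :
  eval g (canon t) = eval g t.
Proof.
have /andP[/asboolP tc /asboolP ct] := canon_eqv t.
by apply/le_anti; rewrite tc ct.
Qed.

Section FreeMorphism.
Variables (d : Order.disp_t) (L : latticeType d) (g : X -> L).

Definition free_lift (a : free) : L := eval g (val a).

Fact free_liftI : {morph free_lift : a b / a `&` b}.
Proof. by move=> a b; rewrite /free_lift /= eval_canon. Qed.

Fact free_liftU : {morph free_lift : a b / a `|` b}.
Proof. by move=> a b; rewrite /free_lift /= eval_canon. Qed.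

End FreeMorphism.

Lemma eval_free_var (t : term X) : eval free_var t = free_class t.
Proof.
elim: t => //= t1 -> t2 ->; apply/val_inj/eq_canon;
  apply/andP; split; apply/asboolP => d L g /=; by rewrite !eval_canon.
Qed.

Lemma free_var_generates : generates free_var.
Proof.
move=> a; exists (val a); rewrite eval_free_var.
exact/val_inj/eqP/(valP a).
Qed.

Lemma free_lattice_free : free_lattice free_var.
Proof.
move=> d L g.
exists (lmorphism_of (free_liftI g) (free_liftU g)); split.
  by move=> x; rewrite /= /free_lift /= eval_canon.
move=> h hg a; have [t <-] := free_var_generates a.
rewrite !morph_eval; elim: t => /= [x|t1 -> t2 ->|t1 -> t2 ->] //.
by move: (hg x); rewrite /= /free_lift /= eval_canon.
Qed.

End FreeLattice.

(** * Whitman's condition for free lattices *)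

Section GeneratedSublattice.
Variables (X : Type) (d : Order.disp_t) (F : latticeType d) (i : X -> F).

Definition is_generated (x : F) : bool := `[< exists t, eval i t = x >].

Definition generated : Type := {x : F | is_generated x}.

HB.instance Definition _ := SubChoice.copy generated {x : F | is_generated x}.

Implicit Types a b c : generated.

Fact generated_meet_subproof a b : is_generated (val a `&` val b).
Proof.
have [/asboolP[s sa] /asboolP[t tb]] := (valP a, valP b).
by apply/asboolP; exists (Meet s t); rewrite /= sa tb.
Qed.

Fact generated_join_subproof a b : is_generated (val a `|` val b).
Proof.
have [/asboolP[s sa] /asboolP[t tb]] := (valP a, valP b).
by apply/asboolP; exists (Join s t); rewrite /= sa tb.
Qed.

Fact generated_var_subproof x : is_generated (i x).
Proof. by apply/asboolP; exists (Var x). Qed.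

Definition generated_le a b := val a <= val b.
Definition generated_meet a b : generated := Sub _ (generated_meet_subproof a b).
Definition generated_join a b : generated := Sub _ (generated_join_subproof a b).
Definition generated_var x : generated := Sub _ (generated_var_subproof x).

Fact generated_le_refl : reflexive generated_le. Proof. by move=> a; apply: lexx. Qed.
Fact generated_le_anti : antisymmetric generated_le.
Proof. by move=> a b /le_anti/val_inj. Qed.
Fact generated_le_trans : transitive generated_le.
Proof. by move=> b a c; apply: le_trans. Qed.

HB.instance Definition _ := Order.Le_isPOrder.Build d generated
  generated_le_refl generated_le_anti generated_le_trans.

Fact generated_meetP a b c : (a <= generated_meet b c) = (a <= b) && (a <= c).
Proof. exact: lexI. Qed.
Fact generated_joinP a b c : (generated_join a b <= c) = (a <= c) && (b <= c).
Proof. exact: leUx. Qed.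

HB.instance Definition _ := Order.POrder_MeetJoin_isLattice.Build d generated
  generated_meetP generated_joinP.

End GeneratedSublattice.

Section FreeLatticeTheory.
Variables (X : Type) (d : Order.disp_t) (F : latticeType d) (i : X -> F).
Hypothesis free_i : free_lattice i.

Lemma free_endo (f : F -> F) :
  {morph f : x y / x `&` y} -> {morph f : x y / x `|` y} ->
  f \o i =1 i -> f =1 id.
Proof.
move=> fI fU fi x; have [h [hi huniq]] := free_i i.
rewrite -[f x]/(lmorphism_of fI fU x) huniq // -(huniq (idfun : {lmorphism F -> F})) //.
Qed.

(** The lift of [generated_var], followed by the inclusion, is an endomorphism fixing the
    generators, hence the identity; so every element lies in the generated sublattice. *)
Lemma free_generates : generates i.
Proof.
move=> y; have [h [hi _]] := free_i (generated_var i).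
have /(_ y) <- : val \o h =1 id.
  apply: free_endo => [a b|a b|x] /=; first by rewrite omorphI.
    by rewrite omorphU.
  by have /= -> := hi x.
by have /asboolP := valP (h y).
Qed.

End FreeLatticeTheory.

(* Day's doubling of the interval [v, u]: the elements of the interval occur
   with both labels, the other elements above v only with label true, and the
   remaining ones only with label false. *)
Section Doubling.
Variables (d : Order.disp_t) (F : latticeType d) (v u : F).

Definition doubling_pred (p : F * bool) :=
  if p.2 then v <= p.1 else (v <= p.1) ==> (p.1 <= u).

Definition doubling : Type := {p : F * bool | doubling_pred p}.

HB.instance Definition _ := SubChoice.copy doubling {p : F * bool | doubling_pred p}.

Implicit Types a b c : doubling.

Definition doubling_le a b :=
  ((val a).1 <= (val b).1) && ((val a).2 ==> (val b).2).

Fact doubling_meet_subproof a b :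
  doubling_pred ((val a).1 `&` (val b).1, (val a).2 && (val b).2).
Proof.
move: (valP a) (valP b); rewrite /doubling_pred; case: (val a) (val b) => [x s] [y t] /=.
case: s t => -[] //=; rewrite lexI; first by move=> -> ->.
- by move=> _ /implyP ut; apply/implyP => /andP[_ /ut]; apply/le_trans/leIr.
- by move=> /implyP ut _; apply/implyP => /andP[/ut + _]; apply/le_trans/leIl.
- by move=> /implyP ut _; apply/implyP => /andP[/ut + _]; apply/le_trans/leIl.
Qed.

(** Such elements carry only the label true, so a join of two elements labelled false must be
    relabelled when it lands among them. *)
Definition doubling_label (x : F) := (v <= x) && ~~ (x <= u).

Fact doubling_join_subproof a b (x := (val a).1 `|` (val b).1) :
  doubling_pred (x, [|| (val a).2, (val b).2 | doubling_label x]).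
Proof.
rewrite /x; move: (valP a) (valP b); rewrite /doubling_pred.
case: (val a) (val b) => [y s] [z t] /=.
case: s => /= [vy _|_]; first exact: le_trans vy (leUl _ _).
case: t => /= [vz|_]; first exact: le_trans vz (leUr _ _).
by rewrite /doubling_label; case: (v <= _); case: (_ <= u).
Qed.

Definition doubling_meet a b : doubling := Sub _ (doubling_meet_subproof a b).
Definition doubling_join a b : doubling := Sub _ (doubling_join_subproof a b).

Fact doubling_le_refl : reflexive doubling_le.
Proof. by move=> a; rewrite /doubling_le lexx implybb. Qed.
Fact doubling_le_anti : antisymmetric doubling_le.
Proof.
move=> a b /andP[/andP[ab sab] /andP[ba sba]]; apply: val_inj.
move: ab sab ba sba; case: (val a) (val b) => [x s] [y t] /= xy st yx ts.
congr pair; first by apply: le_anti; rewrite xy.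
by case: s t st ts => -[].
Qed.
Fact doubling_le_trans : transitive doubling_le.
Proof.
move=> b a c /andP[ab sab] /andP[bc sbc]; rewrite /doubling_le (le_trans ab bc).
by apply/implyP => /(implyP sab)/(implyP sbc).
Qed.

HB.instance Definition _ := Order.Le_isPOrder.Build d doubling
  doubling_le_refl doubling_le_anti doubling_le_trans.

Fact doubling_meetP a b c : (a <= doubling_meet b c) = (a <= b) && (a <= c).
Proof.
rewrite /Order.le /= /doubling_le /= lexI.
by case: (val a).2; case: (val b).2; case: (val c).2; rewrite /= ?andbT ?andbF.
Qed.

Fact doubling_joinP a b c : (doubling_join a b <= c) = (a <= c) && (b <= c).
Proof.
rewrite /Order.le /= /doubling_le /= leUx.
case ac: (_ <= _) => //=; case bc: (_ <= _); rewrite /= ?andbF //.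
have labelP : doubling_label ((val a).1 `|` (val b).1) ==> (val c).2.
  apply/implyP => /andP[vab abu]; have := valP c; rewrite /doubling_pred.
  case: (val c).2 => //=.
  have abc : (val a).1 `|` (val b).1 <= (val c).1 by rewrite leUx ac bc.
  rewrite (le_trans vab abc) /= => cu.
  by rewrite (le_trans abc cu) in abu.
by move: labelP; case: (val a).2; case: (val b).2; case: (val c).2;
  rewrite /= ?andbT ?implybT ?implybF.
Qed.

HB.instance Definition _ := Order.POrder_MeetJoin_isLattice.Build d doubling
  doubling_meetP doubling_joinP.

End Doubling.

Section Whitman.
Variables (X : Type) (d : Order.disp_t) (F : latticeType d) (i : X -> F).
Hypothesis free_i : free_lattice i.

(** A labelling of the generators lifts to a morphism into the doubling. Its first component fixes
    the generators, hence is the identity; its second component is [l]. *)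
Lemma free_doubling_label (v u : F) (lab : X -> bool) :
    (forall x, doubling_pred v u (i x, lab x)) ->
  exists l : F -> bool,
    [/\ forall x, l (i x) = lab x, forall x, doubling_pred v u (x, l x),
        {homo l : x y / x <= y >-> x ==> y},
        forall x y, l (x `&` y) = l x && l y
      & forall x y, l (x `|` y) = [|| l x, l y | doubling_label v u (x `|` y)]].
Proof.
move=> lab_ok; pose g x : doubling v u := Sub (i x, lab x) (lab_ok x).
have [h [hi _]] := free_i g.
have h1 : (fun x => (val (h x)).1) =1 id.
  apply: (free_endo free_i) => [x y|x y|x] /=; first by rewrite omorphI.
    by rewrite omorphU.
  by have /= -> := hi x.
exists (fun x => (val (h x)).2); split=> [x|x|x y xy|x y|x y].
- by have /= -> := hi x.
- by rewrite -[x in (x, _)]h1 -surjective_pairing; apply: valP.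
- by have /andP[] := omorph_le h xy.
- by rewrite omorphI.
- by rewrite omorphU /= !h1.
Qed.

(** [doubling_label] is the least admissible label of [x], and [v <= x], treated next, the
    greatest. *)
Lemma doubling_pred_label (v u x : F) : doubling_pred v u (x, doubling_label v u x).
Proof. by rewrite /doubling_pred /doubling_label /=; case: (v <= x); case: (x <= u). Qed.

Lemma doubling_pred_above (v u x : F) : doubling_pred v u (x, v <= x).
Proof. by rewrite /doubling_pred /=; case: ifP => [->|->]. Qed.

(** If all four alternatives fail, the labels of [a] and [b] are forced to be true and those of [c]
    and [e] false. Then [v] is labelled true and [u] false, against the monotonicity of [l]. *)
Lemma free_whitman (a b c e : F) : a `&` b <= c `|` e ->
  [\/ a <= c `|` e, b <= c `|` e, a `&` b <= c | a `&` b <= e].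
Proof.
move=> le_vu; set v := a `&` b in le_vu *; set u := c `|` e in le_vu *.
have [l [_ l_ok l_homo lI lU]] :=
  free_doubling_label (fun x => doubling_pred_label v u (i x)).
case au: (a <= u); first by constructor 1.
case bu: (b <= u); first by constructor 2.
case vc: (v <= c); first by constructor 3.
case ve: (v <= e); first by constructor 4.
have la : l a by have := l_ok a; rewrite /doubling_pred /= leIl au; case: (l a).
have lb : l b by have := l_ok b; rewrite /doubling_pred /= leIr bu; case: (l b).
have lc : l c = false by have := l_ok c; rewrite /doubling_pred /= vc; case: (l c).
have le : l e = false by have := l_ok e; rewrite /doubling_pred /= ve; case: (l e).
by have := l_homo _ _ le_vu; rewrite lI la lb lU lc le /doubling_label lexx andbF.
Qed.

(** Here [v] is the generator itself, and the greatest labelling makes it true; if neither [a] nor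
    [b] is above [v], both get false, and so does their join. *)
Lemma free_join_prime x (a b : F) : i x <= a `|` b -> i x <= a \/ i x <= b.
Proof.
move=> le_vu; set v := i x in le_vu *; set u := a `|` b in le_vu *.
have [l [li l_ok l_homo lI lU]] :=
  free_doubling_label (fun x => doubling_pred_above v u (i x)).
case va: (v <= a); first by left.
case vb: (v <= b); first by right.
have la : l a = false by have := l_ok a; rewrite /doubling_pred /= va; case: (l a).
have lb : l b = false by have := l_ok b; rewrite /doubling_pred /= vb; case: (l b).
by have := l_homo _ _ le_vu; rewrite li lexx lU la lb /doubling_label lexx andbF.
Qed.

Lemma free_meet_prime x (a b : F) : a `&` b <= i x -> a <= i x \/ b <= i x.
Proof.
move=> le_vu; set u := i x in le_vu *; set v := a `&` b in le_vu *.
have [l [li l_ok l_homo lI lU]] :=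
  free_doubling_label (fun x => doubling_pred_label v u (i x)).
case au: (a <= u); first by left.
case bu: (b <= u); first by right.
have la : l a by have := l_ok a; rewrite /doubling_pred /= leIl au; case: (l a).
have lb : l b by have := l_ok b; rewrite /doubling_pred /= leIr bu; case: (l b).
by have := l_homo _ _ le_vu; rewrite lI la lb li /doubling_label lexx andbF.
Qed.

End Whitman.

(** * Semidistributivity of bounded images of free lattices *)

Lemma has_split (T : Type) (p : pred T) (s : seq T) : has p s ->
  exists s1 x s2, s = s1 ++ x :: s2 /\ p x.
Proof.
elim: s => //= y s IHs /orP[py|/IHs[s1 [x [s2 [-> px]]]]].
  by exists [::], y, s.
by exists (y :: s1), x, s2.
Qed.

Section JoinSemidistributive.
Variables (X : Type) (d : Order.disp_t) (F : latticeType d) (i : X -> F).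
Hypothesis gen_i : generates i.
Hypothesis whitman : forall a b c e : F, a `&` b <= c `|` e ->
  [\/ a <= c `|` e, b <= c `|` e, a `&` b <= c | a `&` b <= e].
Hypothesis join_prime : forall x (a b : F), i x <= a `|` b -> i x <= a \/ i x <= b.

Let sum_size (s : seq (term X)) := sumn (map (@term_size X) s).

(** Upper bounds replace the join of the list because [F] need not have a least element to serve as
    the empty join. *)
Definition join_representation (u : F) (s : seq (term X)) :=
  forall z, (u <= z) = all (fun t => eval i t <= z) s.

Definition refines_joins (u : F) (s : seq (term X)) :=
  forall a b, u = a `|` b -> all (fun t => (eval i t <= a) || (eval i t <= b)) s.

(* A join representation of u of minimal size refines all the others: otherwise
   a join term can be replaced with its two summands, or Whitman's condition
   allows replacing a meet term with one of its factors. *)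
Lemma canonical_joinands (u : F) :
  exists2 s, join_representation u s & refines_joins u s.
Proof.
have [t0 t0u] := gen_i u.
have [n le_sn] : exists n, (sum_size [:: t0] < n)%N by exists (sum_size [:: t0]).+1.
have : join_representation u [:: t0] by move=> z /=; rewrite t0u andbT.
elim: n [:: t0] le_sn => // n IHn s le_sn us.
pose good t := `[< forall a b, u = a `|` b -> (eval i t <= a) || (eval i t <= b) >].
have [all_good|] := boolP (all good s).
  exists s => // a b uab.
  by apply: sub_all all_good => t /asboolP; apply.
rewrite -has_predC => /has_split[s1 [t [s2 [s_eq /asboolPn]]]].
move=> /existsNP[a /existsNP[b /not_implyP[uab /negP]]].
rewrite negb_or => /andP[ta tb].
have := us u; rewrite lexx s_eq all_cat /= => /esym/and3P[s1u tu s2u].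
have shrink r : (sum_size r < term_size t)%N ->
    all (fun t' => eval i t' <= u) r ->
    (forall z, all (fun t' => eval i t' <= z) r -> eval i t <= z) ->
  exists2 s, join_representation u s & refines_joins u s.
  move=> r_lt ru rt; apply: (IHn (s1 ++ r ++ s2)) => [|z].
    rewrite ltnS in le_sn; apply: leq_trans le_sn.
    rewrite s_eq /sum_size !map_cat !sumn_cat /= ltn_add2l ltn_add2r //.
  apply/idP/idP => [uz|].
    have h t' : eval i t' <= u -> eval i t' <= z by move/le_trans; apply.
    by rewrite !all_cat (sub_all h s1u) (sub_all h ru) (sub_all h s2u).
  rewrite !all_cat us s_eq all_cat /= => /and3P[-> /rt -> ->] //.
case: t tu ta tb shrink {s_eq} => [x|t1 t2|t1 t2] /= tu ta tb shrink.
- by move: tu; rewrite uab => /join_prime[] h; rewrite h in ta tb.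
- move: (tu); rewrite uab => /whitman[]; rewrite ?(negPf ta) ?(negPf tb) -?uab // => h.
    apply: (shrink [:: t1]) => /= [|| z]; rewrite ?h //.
      by rewrite /sum_size /= addn0 ltnS leq_addr.
    by rewrite andbT; apply/le_trans/leIl.
  apply: (shrink [:: t2]) => /= [|| z]; rewrite ?h //.
    by rewrite /sum_size /= addn0 ltnS leq_addl.
  by rewrite andbT; apply/le_trans/leIr.
apply: (shrink [:: t1; t2]) => /= [||z]; rewrite ?andbT -?leUx //.
by rewrite /sum_size /= addn0 ltnSn.
Qed.

(** Each joinand in the refining representation of the common join is below [z], or else below both
    [x] and [y]. *)
Lemma whitman_join_semidistributive : join_semidistributive F.
Proof.
move=> x y z xy; have [s s_rep s_ref] := canonical_joinands (x `|` z).
apply/le_anti/andP; split; last by rewrite leU2 // leIl.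
rewrite s_rep.
have := s_ref _ _ erefl; have := s_ref _ _ xy; elim: s {s_rep s_ref} => //= t s IHs.
move=> /andP[t1 /IHs sy] /andP[t2 /sy ->]; rewrite andbT.
have [tz|tz] := boolP (eval i t <= z); first exact: le_trans tz (leUr _ _).
move: t1 t2; rewrite (negPf tz) !orbF => ty tx.
by apply: le_trans (leUl _ _); rewrite lexI tx ty.
Qed.

End JoinSemidistributive.

Lemma free_semidistributive (X : Type) (d : Order.disp_t) (F : latticeType d)
    (i : X -> F) : free_lattice i -> semidistributive F.
Proof.
move=> free_i; have gen_i := free_generates free_i; split.
  exact: whitman_join_semidistributive gen_i (free_whitman free_i)
    (free_join_prime free_i).
(* Whitman's condition is self-dual up to a permutation of its alternatives, so the meet half is the
   join half in [F^d]. *)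
apply: (@whitman_join_semidistributive X _ F^d i (generates_dual gen_i)).
  move=> a b c e /(free_whitman free_i) [] h.
  - by constructor 3.
  - by constructor 4.
  - by constructor 1.
  - by constructor 2.
exact: free_meet_prime free_i.
Qed.

(** Taking least preimages preserves joins, so the equality of joins lifts to [F];
    semidistributivity is applied there and the result is mapped back by [f]. *)
Lemma image_join_semidistributive (d d' : Order.disp_t) (F : latticeType d)
    (L : latticeType d') (f : F -> L) :
    {morph f : x y / x `&` y} -> {morph f : x y / x `|` y} ->
    (forall y, exists m, is_least (fun x => f x = y) m) ->
  join_semidistributive F -> join_semidistributive L.
Proof.
move=> fI fU least sdF x y z xyz.
have [bx [fbx bx_le]] := least x.
have [by_ [fby by_le]] := least y.
have [bz [fbz bz_le]] := least z.
have [bu [fbu bu_le]] := least (x `|` z).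
have bu_eq w bw : f bw = w -> (forall t, f t = w -> bw <= t) ->
    w `|` z = x `|` z -> bw `|` bz = bu.
  move=> fbw bw_le wz; apply/le_anti; rewrite bu_le ?fU ?fbw ?fbz //.
  (* Least preimages are monotone: the meet of [bw'] with [bu] is still a preimage of [w']. *)
  have below w' bw' : (forall t, f t = w' -> bw' <= t) -> f bw' = w' ->
      w' <= x `|` z -> bw' <= bu.
    move=> bw'_le fbw' /meet_idPl w'u.
    have /bw'_le : f (bw' `&` bu) = w' by rewrite fI fbw' fbu w'u.
    by rewrite lexI => /andP[].
  rewrite leUx (below w) // -?wz ?leUl //.
  by rewrite (below z) ?leUr.
rewrite -fbu -(bu_eq x bx) // (sdF bx by_ bz) ?(bu_eq x bx) ?(bu_eq y by_) //.
by rewrite fU fI fbx fby fbz.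
Qed.

Lemma bounded_image_semidistributive (d : Order.disp_t) (L : latticeType d) :
  bounded_image_of_free L -> semidistributive L.
Proof.
move=> [X [d' [F [i [/free_semidistributive[sdj sdm] [f [_ fib]]]]]]]; split.
  apply: (@image_join_semidistributive _ _ F L f) sdj.
  - exact: omorphI.
  - exact: omorphU.
  - by move=> y; case: (fib y).
apply: (@image_join_semidistributive _ _ F^d L^d f) sdm.
- exact: (omorphU f).
- exact: (omorphI f).
- by move=> y; case: (fib y).
Qed.

Lemma semidistributive_pseudocomplemented (d : Order.disp_t)
    (L : finTBLatticeType d) : meet_semidistributive L -> pseudocomplemented L.
Proof.
move=> sdm x; exists (\join_(y | x `&` y == \bot) y); split.
  elim/big_ind: _ => [|y z xy xz|y /eqP //]; first exact: meetx0.
  by rewrite meetC -sdm ?[_ `&` x]meetC ?xy ?xz.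
by move=> y /eqP xy; apply: joins_sup.
Qed.

(** * Lower bounded morphisms onto finite lattices *)

(* [j p], for [p] ranging over [valid], is join-dense, and every nontrivial
   binary join cover of [j p] is refined by a join cover made of generators of
   smaller rank; joins are expressed through their upper bounds. *)
Definition ranked_join_generators (d : Order.disp_t) (L : latticeType d)
    (I : Type) (valid : pred I) (j : I -> L) (rank : I -> nat) : Prop :=
  (forall y z, (forall p, valid p -> j p <= y -> j p <= z) -> y <= z) /\
  (forall p a b, valid p -> j p <= a `|` b -> ~~ (j p <= a) -> ~~ (j p <= b) ->
     forall z, (forall s, valid s -> (rank s < rank p)%N ->
                  (j s <= a) || (j s <= b) -> j s <= z) -> j p <= z).

Section LowerBounded.
Variables (d d' : Order.disp_t) (F : latticeType d) (L : finTBLatticeType d').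
Variables (i : L -> F) (f : F -> L).
Hypotheses (fI : {morph f : x y / x `&` y}) (fU : {morph f : x y / x `|` y}).
Hypotheses (gen_i : generates i) (fi : cancel i f).
Variables (I : finType) (valid : pred I) (j : I -> L) (rank : I -> nat).
Hypothesis ranked : ranked_join_generators valid j rank.

Let f_homo x y : x <= y -> f x <= f y.
Proof. by move=> /meet_idPl xy; rewrite -xy fI leIr. Qed.

(** The extra element [w] starts the meet, since [F] need not have a greatest element. *)
Lemma exists_lower_bound (y : L) (s : seq F) (w : F) :
    y <= f w -> all (fun t => y <= f t) s ->
  exists m, [/\ m <= w, all (fun t => m <= t) s & y <= f m].
Proof.
move=> yw; elim: s => [|t s IHs] /=; first by exists w; rewrite lexx.
case/andP=> yt /IHs[m [mw ms ym]]; exists (t `&` m); split.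
- exact: le_trans (leIr _ _) mw.
- by rewrite leIl; apply: sub_all ms => t' /(le_trans _); apply; apply: leIr.
- by rewrite fI lexI yt.
Qed.

(** The generators are indexed by the finite lattice [L], so they have a common lower bound, which
    is below every term by induction. *)
Lemma exists_bottom : exists m : F, forall t, m <= t.
Proof.
have [|m [_ ms _]] := @exists_lower_bound \bot [seq i x | x <- enum L] (i \bot) (le0x _).
  by apply/allP => t _; apply: le0x.
exists m => t; have [tau <-] := gen_i t.
elim: tau => /= [x|t1 h1 t2 h2|t1 h1 t2 _].
- by apply: (allP ms); apply: map_f; rewrite mem_enum.
- by rewrite lexI h1.
- exact: le_trans h1 (leUl _ _).
Qed.

Lemma exists_join (s : seq F) : exists m : F,
  (forall z, (m <= z) = all (fun t => t <= z) s) /\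
  (forall z, (f m <= z) = all (fun t => f t <= z) s).
Proof.
elim: s => [|t s [m [m_le fm_le]]] /=.
  (* The bottom of [F] maps to the bottom of [L], because it lies below [i z] for every [z]. *)
  have [m m_le] := exists_bottom; exists m; split=> z; rewrite ?m_le //.
  by rewrite -[z]fi f_homo.
by exists (t `|` m); split=> z; rewrite ?fU leUx ?m_le ?fm_le.
Qed.

(** The element [b] is a lower bound of finitely many candidates: the generators [i x] with
    [j p <= x] and, for each nontrivial cover of [j p], the join of the elements already found for
    the smaller generators refining it. The refinement property keeps [f b] above [j p]; minimality
    is by induction on terms. *)
Lemma least_above_generator p : valid p ->
  exists b, f b = j p /\ forall t, j p <= f t -> b <= t.
Proof.
have [jgen jcov] := ranked.
have [n] := ubnP (rank p); elim: n p => // n IHn p lt_pn vp.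
have /fin_all_exists[beta betaP] : forall s, exists b,
    valid s && (rank s < rank p)%N -> f b = j s /\ forall t, j s <= f t -> b <= t.
  (* The value [i \bot] is an arbitrary default outside the range of the induction. *)
  move=> s; case vs: (valid s && (rank s < rank p)%N); last by exists (i \bot).
  have [vs' lt_sp] := andP vs.
  have [b bP] := IHn s (leq_trans lt_sp lt_pn) vs'.
  by exists b.
pose small (ab : L * L) s := [&& valid s, (rank s < rank p)%N
  & (j s <= ab.1) || (j s <= ab.2)].
have /fin_all_exists[sup supP] := fun ab =>
  exists_join [seq beta s | s <- enum I & small ab s].
pose cover (ab : L * L) :=
  [&& j p <= ab.1 `|` ab.2, ~~ (j p <= ab.1) & ~~ (j p <= ab.2)].
pose cands := [seq i x | x <- enum L & j p <= x] ++
              [seq sup ab | ab <- enum {: L * L} & cover ab].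
have [||b [b_p b_cands pb]] := @exists_lower_bound (j p) cands (i (j p)).
- by rewrite fi.
- rewrite all_cat; apply/andP; split; apply/allP => t /mapP[].
    by move=> x + ->; rewrite mem_filter fi => /andP[].
  move=> ab + ->; rewrite mem_filter => /andP[/and3P[pab pa pb] _].
  apply: (jcov p ab.1 ab.2) => // s vs lt_sp sab.
  have := (supP ab).2 (f (sup ab)); rewrite lexx => /esym/allP/(_ (beta s)).
  have [|<- _] := betaP s; first by rewrite vs.
  by apply; apply: map_f; rewrite mem_filter mem_enum /small vs lt_sp sab.
exists b; split; first by apply: le_anti; rewrite pb -[leRHS]fi f_homo.
move=> t; have [tau <-] := gen_i t.
move: b_cands; rewrite all_cat => /andP[/allP bx /allP bab].
elim: tau => /= [x|t1 h1 t2 h2|t1 h1 t2 h2].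
- rewrite fi => px; apply: bx; apply: map_f.
  by rewrite mem_filter px mem_enum.
- by rewrite fI !lexI => /andP[/h1-> /h2->].
rewrite fU => pt.
have [/h1 bt1|pt1] := boolP (j p <= f (eval i t1)); first exact: le_trans bt1 (leUl _ _).
have [/h2 bt2|pt2] := boolP (j p <= f (eval i t2)); first exact: le_trans bt2 (leUr _ _).
(* Neither summand has image above [j p], so the two images form a nontrivial cover, and its
   candidate is below the join of the two terms. *)
pose ab := (f (eval i t1), f (eval i t2)).
apply: (@le_trans _ _ (sup ab)).
  apply: bab; apply: map_f; by rewrite mem_filter /cover pt pt1 pt2 mem_enum.
rewrite (supP ab).1; apply/allP => _ /mapP[s + ->].
rewrite mem_filter => /andP[/and3P[vs lt_sp st] _].
have [|_ bs] := betaP s; first by rewrite vs.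
by case/orP: st => /bs bs_t; apply: le_trans bs_t _; rewrite ?leUl ?leUr.
Qed.

(** The least preimage of [y] is the join of the elements [beta s] over the generators [j s] below
    [y]. *)
Lemma fiber_has_least (y : L) : exists m, is_least (fun x => f x = y) m.
Proof.
have [jgen _] := ranked.
have /fin_all_exists[beta betaP] : forall s, exists b,
    valid s -> f b = j s /\ forall t, j s <= f t -> b <= t.
  move=> s; case vs: (valid s); last by exists (i \bot).
  by have [b bP] := least_above_generator vs; exists b.
have [m [m_le fm_le]] := exists_join [seq beta s | s <- enum I & valid s && (j s <= y)].
exists m; split=> [|x fx].
  apply: le_anti; apply/andP; split.
    rewrite fm_le; apply/allP => _ /mapP[s + ->].
    by rewrite mem_filter => /andP[/andP[/betaP[-> _] ->]].
  apply: jgen => p vp py; have [<- _] := betaP p vp.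
  have := fm_le (f m); rewrite lexx => /esym/allP; apply.
  by apply: map_f; rewrite mem_filter vp py mem_enum.
rewrite m_le; apply/allP => _ /mapP[s + ->].
rewrite mem_filter => /andP[/andP[/betaP[_ bs] sy] _].
by apply: bs; rewrite fx.
Qed.

End LowerBounded.

(** The free lattice is taken on the elements of [L], so [i] is a section of [f] and surjectivity is
    immediate. The complement carries the ranked generators to [L^d], where least fiber elements are
    the greatest ones for [L]. *)
Lemma ranked_bounded_image (d : Order.disp_t) (L : finTBLatticeType d)
    (compl : L -> L) (I : finType) (valid : pred I) (j : I -> L) (rank : I -> nat) :
    involutive compl -> {mono compl : x y / x <= y >-> y <= x} ->
    ranked_join_generators valid j rank ->
  bounded_image_of_free L.
Proof.
move=> complK compl_le ranked.
pose i := @free_var L; pose g : L -> L := id.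
pose f := lmorphism_of (free_liftI g) (free_liftU g).
have fi : cancel i f by move=> x; rewrite /f /= /free_lift /= eval_canon.
have gen_i : generates i := @free_var_generates L.
have [fI fU] := (free_liftI g, free_liftU g).
have complU a b : compl (a `|` b) = compl a `&` compl b.
  apply/le_anti/andP; split; first by rewrite lexI !compl_le leUl leUr.
  rewrite -[_ `&` _]complK compl_le leUx -{1}[a]complK -{2}[b]complK.
  by rewrite !compl_le leIl leIr.
have complI a b : compl (a `&` b) = compl a `|` compl b.
  by rewrite -[RHS]complK complU !complK.
exists L, _, _, i; split; first exact: free_lattice_free.
exists f; split=> [y|y]; first by exists (i y).
split; first exact: (fiber_has_least fI fU gen_i fi ranked).
have [jgen jcov] := ranked.
apply: (@fiber_has_least _ _ (free L)^d L^d i f fU fI (generates_dual gen_i) fi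
  I valid (compl \o j) rank).
have dualE x q : ((compl \o j) q <= x :> L^d) = (j q <= compl x).
  by rewrite -[LHS]/(x <= compl (j q) :> L) -compl_le complK.
split=> [{}y z yz|p a b vp pab pa pb z sz].
  rewrite -[y <= z]/(z <= y :> L) -compl_le; apply: jgen => p vp.
  by have := yz p vp; rewrite !dualE.
rewrite dualE; apply: (jcov p (compl a) (compl b)) => //.
- rewrite -complI; have := pab; by rewrite dualE.
- by have := pa; rewrite dualE.
- by have := pb; rewrite dualE.
by move=> s vs lt_sp; have := sz s vs lt_sp; rewrite !dualE.
Qed.

(** * Clopen sets attached to pairs *)

Section RegularClosed.
Variables (E : finType) (e : {set E * E}) (te : set_transitive e).
Implicit Types (a b x y z : E) (U : {set E}) (A B D : Reg te) (G O : {set E * E}).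

Let e_trans y x z : (x, y) \in e -> (y, z) \in e -> (x, z) \in e.
Proof. by move: y x z; apply/set_transitiveP. Qed.

Let reg_trans A y x z : (x, y) \in val A -> (y, z) \in val A -> (x, z) \in val A.
Proof. by move: y x z; apply/set_transitiveP; apply: regular_closed_trans (valP A). Qed.

Let reg_e A x y : (x, y) \in val A -> (x, y) \in e.
Proof. by apply: subsetP; case/andP: (valP A). Qed.

Let cl_trans G y x z : (x, y) \in cl G -> (y, z) \in cl G -> (x, z) \in cl G.
Proof. by move: y x z; apply/set_transitiveP; apply: cl_transitive. Qed.

Lemma trile_refl x : trile e x x. Proof. by rewrite /trile /= eqxx orbT. Qed.

Lemma trileW x y : (x, y) \in e -> trile e x y.
Proof. by rewrite /trile /= => ->. Qed.

Lemma trile_neq x y : trile e x y -> x != y -> (x, y) \in e.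
Proof. by case/orP=> // /eqP ->; rewrite eqxx. Qed.

Lemma trile_trans y x z : trile e x y -> trile e y z -> trile e x z.
Proof.
case/orP=> [xy|/eqP->//] /orP[yz|/eqP<-]; last exact: trileW.
exact/trileW/(e_trans xy yz).
Qed.

Lemma trile_in y x z : trile e x y -> (y, z) \in e -> (x, z) \in e.
Proof. by case/orP=> [xy yz|/eqP->//]; apply: e_trans xy yz. Qed.

(** Since [cl] is an intersection of transitive sets, induction amounts to checking that the pairs
    of [cl G] satisfying [P] form such a set containing [G]. *)
Lemma cl_ind G (P : E -> E -> Prop) :
    (forall x y, (x, y) \in G -> P x y) ->
    (forall y x z, (x, y) \in cl G -> (y, z) \in cl G -> P x y -> P y z -> P x z) ->
  forall x y, (x, y) \in cl G -> P x y.
Proof.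
move=> PG Ptr x y xy; pose S := [set p in cl G | `[< P p.1 p.2 >]].
suff /subsetP/(_ _ xy) : cl G \subset S by rewrite inE => /andP[_ /asboolP].
apply: cl_sub.
  apply/set_transitiveP => v u w; rewrite /= !inE /=.
  move=> /andP[uv /asboolP Puv] /andP[vw /asboolP Pvw].
  by rewrite (cl_trans uv vw); apply/asboolP; apply: Ptr Puv Pvw.
by apply/subsetP => -[u v] uv; rewrite inE (subsetP (sub_cl _)) //=; apply/asboolP/PG.
Qed.

Lemma cl_split G x y : (x, y) \in cl G -> x != y ->
  (x, y) \in G \/ exists z, [/\ z != x, z != y, (x, z) \in cl G & (z, y) \in cl G].
Proof.
move: x y; apply: cl_ind.
  by move=> x y xy _; left.
move=> y x z xy yz IHxy IHyz xz.
have [xy_eq|xy_neq] := eqVneq x y; first by rewrite xy_eq; apply: IHyz; rewrite -xy_eq.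
have [yz_eq|yz_neq] := eqVneq y z; first by rewrite -yz_eq; apply: IHxy.
by right; exists y; rewrite eq_sym.
Qed.

Lemma open_split O x y z : is_open e O -> (x, z) \in O ->
  (x, y) \in e -> (y, z) \in e -> (x, y) \in O \/ (y, z) \in O.
Proof.
move=> /andP[_ /set_transitiveP tO] xzO xy yz; apply/orP.
apply: contraLR xzO; rewrite negb_or => /andP[xyO yzO].
by have := tO y x z; rewrite /= !inE xyO yzO xy yz => /(_ isT isT) /andP[].
Qed.

Lemma reg_cl_int A : val A = cl (interior e (val A)).
Proof. by case/andP: (valP A) => _ /eqP. Qed.

Lemma reg_leE A B : (A <= B) = (val A \subset val B). Proof. by []. Qed.

(** This allows pairs of a join to be built from pairs of open sets, to which [open_split] and
    [open_clopen] apply. *)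
Lemma cl_regU A B : cl (val A :|: val B) =
  cl (interior e (val A) :|: interior e (val B)).
Proof.
apply/eqP; rewrite eqEsubset; apply/andP; split; last by rewrite clS // setUSS ?int_sub.
apply: cl_sub; first exact: cl_transitive.
rewrite {1}(reg_cl_int A) {1}(reg_cl_int B) subUset.
by rewrite !clS ?subsetUl ?subsetUr.
Qed.

Lemma cl_regU_e A B x y : (x, y) \in cl (val A :|: val B) -> (x, y) \in e.
Proof.
apply/subsetP/cl_sub => //; rewrite subUset.
by case/andP: (valP A) => ->; case/andP: (valP B).
Qed.

Definition clopen a b U : {set E * E} :=
  [set p in e | [&& trile e a p.1, trile e p.2 b,
                    (p.1 == a) || (p.1 \notin U) & (p.2 == b) || (p.2 \in U)]].

Lemma in_clopen a b U x y : ((x, y) \in clopen a b U) =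
  [&& (x, y) \in e, trile e a x, trile e y b,
      (x == a) || (x \notin U) & (y == b) || (y \in U)].
Proof. by rewrite inE. Qed.

Lemma clopen_closed a b U : set_transitive (clopen a b U).
Proof.
apply/set_transitiveP => y x z /=; rewrite !in_clopen.
move=> /and5P[xy -> _ -> _] /and5P[yz _ -> _ ->].
by rewrite (e_trans xy yz).
Qed.

Lemma clopen_open a b U : is_open e (clopen a b U).
Proof.
apply/andP; split; first by apply/subsetP => p; rewrite inE => /andP[].
apply/set_transitiveP => y x z /=; rewrite !in_setD !in_clopen.
move=> /andP[xyN xy] /andP[yzN yz]; rewrite (e_trans xy yz) andbT /=.
(* If [(x, z)] were in the set, then so would be [(x, y)] when the middle point is in [U], and
   [(y, z)] otherwise. *)
apply/and4P => -[ax zb xU zU]; have [yU|yU] := boolP (y \in U).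
  move: xyN; rewrite xy ax xU yU orbT !andbT /= => /negP; apply.
  exact: trile_trans (trileW yz) zb.
move: yzN; rewrite yz zb zU yU orbT !andbT /= => /negP; apply.
exact: trile_trans ax (trileW xy).
Qed.

Lemma clopen_regular a b U : regular_closed e (clopen a b U).
Proof.
rewrite /regular_closed (int_id (clopen_open _ _ _)) cl_id ?clopen_closed //.
by rewrite eqxx andbT; case/andP: (clopen_open a b U).
Qed.

Definition reg_clopen (p : E * E * {set E}) : Reg te :=
  Sub (clopen p.1.1 p.1.2 p.2) (clopen_regular _ _ _).

Lemma mem_clopen a b U : (a, b) \in e -> (a, b) \in clopen a b U.
Proof. by move=> ab; rewrite in_clopen ab !trile_refl !eqxx. Qed.

(** With distinct endpoints, this normalisation of [U] reduces the last two clauses of [clopen] to: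
    source outside [U], target in [U]. *)
Definition valid_index (p : E * E * {set E}) : bool :=
  ((p.1.1, p.1.2) \in e) &&
  ((p.1.1 != p.1.2) ==> (p.1.1 \notin p.2) && (p.1.2 \in p.2)).

(** For [(u, v)] in the clopen set with [u] distinct from [x], the pair [(x, v)] is in [O] while
    [(x, u)] is not, so openness puts [(u, v)] in [O]. *)
Lemma open_clopen O x y : is_open e O -> (x, y) \in O ->
  let U := [set z | ((x, z) \in O) && (z != x)] in
  valid_index (x, y, U) /\ clopen x y U \subset O.
Proof.
move=> opO xyO U; have /andP[/subsetP Oe _] := opO; split.
  rewrite /valid_index /= !inE Oe //= eqxx andbF /= xyO eq_sym.
  by case: eqVneq.
apply/subsetP => -[u v]; rewrite in_clopen !inE => /and5P[uv xu vy].
have [->|ux] := eqVneq u x => /=; first by move=> _ /orP[/eqP->//|/andP[]].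
rewrite andbT => xuO vO.
have xvO : (x, v) \in O by case/orP: vO => [/eqP->|/andP[]].
have xue : (x, u) \in e by apply: trile_neq xu _; rewrite eq_sym.
by case: (open_split opO xvO xue uv) => // h; rewrite h in xuO.
Qed.

(** * Ranks of the clopen sets *)

Definition itv a b : {set E} := [set z | trile e a z && trile e z b].

(** The extra unit ranks a loop [(a, a)] of a two-element component above [(a, c)], whose interval
    has the same elements. Under antisymmetry a loop has a singleton interval, so the rank remains
    monotone. *)
Definition pair_rank a b : nat := #|itv a b| + (a == b).

Definition index_rank (p : E * E * {set E}) : nat := pair_rank p.1.1 p.1.2.

Lemma clopen_join_dense A B :
  (forall p, valid_index p -> reg_clopen p <= A -> reg_clopen p <= B) -> A <= B.
Proof.
move=> AB; rewrite reg_leE reg_cl_int.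
apply: cl_sub; first exact: regular_closed_trans (valP B).
apply/subsetP => -[x y] xyA; have opA := int_open (val A) te.
have [vU UA] := open_clopen opA xyA.
have /AB : reg_clopen (x, y, [set z | ((x, z) \in interior e (val A)) && (z != x)]) <= A.
  exact: subset_trans UA (int_sub _ _).
move=> /(_ vU) /subsetP; apply; apply: mem_clopen.
by case/andP: vU.
Qed.

Definition itv_antisymmetric a b := forall x y,
  trile e a x -> trile e x y -> trile e y x -> trile e x b -> x = y.

Lemma itvS x y u v : trile e x u -> trile e v y -> itv u v \subset itv x y.
Proof.
move=> xu vy; apply/subsetP => z; rewrite !inE => /andP[uz zv].
by rewrite (trile_trans xu uz) (trile_trans zv vy).
Qed.

(** * Join covers over an antisymmetric interval *)

Section AntisymmetricInterval.
Variables a b : E.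
Hypothesis anti : itv_antisymmetric a b.

Lemma pair_rank_mono x y u v : trile e a x -> trile e x u -> trile e u v ->
  trile e v y -> trile e y b -> (pair_rank u v <= pair_rank x y)%N.
Proof.
move=> ax xu uv vy yb; have sub := itvS xu vy; rewrite /pair_rank.
have [uv_eq|_] := eqVneq u v; last by rewrite addn0 (leq_trans (subset_leq_card sub)) ?leq_addr.
have [_|xy] := eqVneq x y; first by rewrite leq_add2r subset_leq_card.
(* The extra unit of the loop is compensated by an endpoint of the larger interval that the loop's
   interval misses. *)
rewrite addn0 addn1; apply: proper_card; rewrite properE sub /=.
apply: contra xy => /subsetP sub'; move: (sub' x) (sub' y).
rewrite !inE !trile_refl (trile_trans xu (trile_trans uv vy)) /=.
move=> /(_ isT) /andP[ux _] /(_ isT) /andP[_ yv].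
apply/eqP; rewrite (anti ax xu ux) ?(trile_trans xu) ?(trile_trans uv) //.
  rewrite uv_eq; apply: anti => //; first by rewrite -uv_eq (trile_trans ax xu).
  exact: trile_trans vy yb.
exact: trile_trans vy yb.
Qed.

Lemma pair_rank_lt x y : a != b -> x != y -> trile e a x -> trile e x y ->
  trile e y b -> (x, y) != (a, b) -> (pair_rank x y < pair_rank a b)%N.
Proof.
move=> ab xy ax xy_le yb; rewrite /pair_rank (negPf ab) (negPf xy) !addn0 => neq.
apply: proper_card; rewrite properE itvS //=; apply: contra neq => /subsetP sub.
have ab_le := trile_trans ax (trile_trans xy_le yb).
move: (sub a) (sub b); rewrite !inE !trile_refl ab_le /=.
move=> /(_ isT) /andP[xa _] /(_ isT) /andP[_ by_].
rewrite (@anti a x) ?trile_refl //.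
by rewrite (@anti b y) ?trile_refl.
Qed.

Variable U : {set E}.
Hypothesis vU : valid_index (a, b, U).
Variables A B Z : Reg te.
Hypothesis cover : clopen a b U \subset cl (val A :|: val B).
Hypotheses (nA : ~~ (clopen a b U \subset val A)) (nB : ~~ (clopen a b U \subset val B)).
Hypothesis small : forall s, valid_index s -> (index_rank s < pair_rank a b)%N ->
  (reg_clopen s <= A) || (reg_clopen s <= B) -> reg_clopen s <= Z.

Let abe : (a, b) \in e. Proof. by case/andP: vU. Qed.

(** The pair is composed of links from the interiors of [A] and [B]. Each link has rank at most that
    of the pair and lies in a clopen set of its own rank, to which [small] applies. *)
Lemma small_pair_in x y : (x, y) \in cl (val A :|: val B) ->
  trile e a x -> trile e y b -> (pair_rank x y < pair_rank a b)%N ->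
  (x, y) \in val Z.
Proof.
have cl_e := @cl_regU_e A B; rewrite cl_regU in cl_e *.
move: x y; apply: cl_ind => [x y xy _ _ lt_xy|].
  have step D : (D <= A) || (D <= B) -> (x, y) \in interior e (val D) -> (x, y) \in val Z.
    move=> DAB xyD; have [vs sD] := open_clopen (int_open (val D) te) xyD.
    have := small vs lt_xy; set p := (x, y, _).
    have le_pD : reg_clopen p <= D by apply: subset_trans sD (int_sub _ _).
    have pAB : (reg_clopen p <= A) || (reg_clopen p <= B).
      by case/orP: DAB => /(le_trans le_pD) ->; rewrite ?orbT.
    by move=> /(_ pAB) /subsetP; apply; apply: mem_clopen; case/andP: vs.
  by case/setUP: xy; apply: step; rewrite lexx ?orbT.
move=> y x z /cl_e/trileW xy /cl_e/trileW yz IHxy IHyz ax zb lt_xz.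
apply: (@reg_trans Z y).
  apply: IHxy => //; first exact: trile_trans yz zb.
  by apply: leq_ltn_trans lt_xz; apply: pair_rank_mono; rewrite ?trile_refl.
apply: IHyz => //; first exact: trile_trans ax xy.
by apply: leq_ltn_trans lt_xz; apply: pair_rank_mono; rewrite ?trile_refl.
Qed.

(** Some pair [(x, y)] of the clopen set is missing from [D]. Splitting [(a, b)] in the interior of
    [D] at [x] or [y] gives a midpoint with one half in [D] and the other half in the clopen set. *)
Lemma clopen_midpoint D : ~~ (clopen a b U \subset val D) ->
    val D \subset cl (val A :|: val B) -> a != b -> (a, b) \in interior e (val D) ->
  exists c, [/\ c != a, c != b, (a, c) \in cl (val A :|: val B)
              & (c, b) \in cl (val A :|: val B)].
Proof.
move=> nD Dcl ab abD; have opD := int_open (val D) te.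
have intD p : p \in interior e (val D) -> p \in val D := subsetP (int_sub _ _) p.
have /andP[aU bU] : (a \notin U) && (b \in U) by case/andP: vU => _; rewrite ab.
case/subsetPn: nD => -[x y]; rewrite in_clopen => /and5P[xy ax yb xU yU] xyD.
have {}xU : x \notin U by case/orP: xU => // /eqP->.
have {}yU : y \in U by case/orP: yU => // /eqP->.
have via_y : (y, b) \in interior e (val D) -> y != b ->
  exists c, [/\ c != a, c != b, (a, c) \in cl (val A :|: val B)
              & (c, b) \in cl (val A :|: val B)].
  move=> ybD yb_neq; exists y; split=> //; first by apply: contraNneq aU => <-.
    by apply: (subsetP cover); rewrite in_clopen (trile_in ax xy) trile_refl yb eqxx yU orbT.
  by apply: (subsetP Dcl); apply: intD.
have [yb_eq|yb_neq] := eqVneq y b.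
  have xa : x != a by apply: contraNneq xyD => ->; rewrite yb_eq; apply: intD.
  have axe : (a, x) \in e by apply: trile_neq ax _; rewrite eq_sym.
  rewrite yb_eq in xy xyD.
  have [axD|xbD] := open_split opD abD axe xy; last by rewrite intD in xyD.
  exists x; split=> //; first by apply: contraNneq xU => ->.
    by apply: (subsetP Dcl); apply: intD.
  by apply: (subsetP cover); rewrite in_clopen xy ax trile_refl eqxx xU orbT.
have ybe := trile_neq yb yb_neq.
have aye := trile_in ax xy.
have [ayD|] := open_split opD abD aye ybe; last by move/via_y; apply.
have [xa|xa] := eqVneq x a; first by move: xyD; rewrite xa intD.
have axe : (a, x) \in e by apply: trile_neq ax _; rewrite eq_sym.
have [axD|xyD'] := open_split opD ayD axe xy; last by rewrite intD in xyD.
exists x; split=> //; first by apply: contraNneq xU => ->.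
  by apply: (subsetP Dcl); apply: intD.
by apply: (subsetP cover); rewrite in_clopen (e_trans xy ybe) ax trile_refl eqxx xU orbT.
Qed.

(** If [a = b], only the loop is present, and it already lies in [A] or [B], a contradiction.
    Otherwise [(a, b)] is composed of two pairs of smaller rank through a midpoint, and all other
    pairs of the clopen set have smaller rank themselves. *)
Lemma antisymmetric_cover : clopen a b U \subset val Z.
Proof.
have ab_cl : (a, b) \in cl (val A :|: val B) by apply: (subsetP cover); apply: mem_clopen.
have [ab|ab] := eqVneq a b.
  have loop x : trile e a x -> trile e x a -> x = a.
    by move=> ax xa; apply: anti => //; rewrite -ab.
  have clopen_ab D : (a, b) \in val D -> clopen a b U \subset val D.
    move=> abD; apply/subsetP => -[x y]; rewrite in_clopen => /and5P[xy ax].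
    rewrite -ab => ya _ _.
    have -> : x = a by apply: loop => //; apply: trile_trans (trileW xy) ya.
    have -> : y = a by apply: loop => //; apply: trile_trans ax (trileW xy).
    by rewrite {2}ab.
  suff : (a, a) \in val A :|: val B.
    rewrite {2}ab => /setUP[] /clopen_ab h; first by case/negP: nA.
    by case/negP: nB.
  suff cl_loop x y : (x, y) \in cl (val A :|: val B) -> x = a -> y = a ->
      (x, y) \in val A :|: val B.
    by apply: cl_loop => //; rewrite {2}ab.
  move: x y; apply: cl_ind => // y x z xy yz IHxy IHyz xa za.
  have ya : y = a.
    apply: loop; apply: trileW; first by rewrite -xa; apply: cl_regU_e xy.
    by rewrite -za; apply: cl_regU_e yz.
  by rewrite za -ya; apply: IHxy.
have [c [ca cb ac_cl cb_cl]] : exists c, [/\ c != a, c != b,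
    (a, c) \in cl (val A :|: val B) & (c, b) \in cl (val A :|: val B)].
  move: (ab_cl); rewrite {1}cl_regU => /cl_split /(_ ab) [/setUP[] abD|].
  - by apply: (@clopen_midpoint A) => //; apply: subset_trans (sub_cl _); apply: subsetUl.
  - by apply: (@clopen_midpoint B) => //; apply: subset_trans (sub_cl _); apply: subsetUr.
  - by rewrite -cl_regU.
have abZ : (a, b) \in val Z.
  have [ac cbe] := (cl_regU_e ac_cl, cl_regU_e cb_cl).
  apply: (@reg_trans Z c); apply: small_pair_in; rewrite ?trile_refl ?trileW //.
    by apply: pair_rank_lt; rewrite ?trile_refl ?trileW // 1?xpair_eqE ?(negPf cb) ?andbF // eq_sym.
  by apply: pair_rank_lt; rewrite ?trile_refl ?trileW // xpair_eqE (negPf ca).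
have /andP[aU bU] : (a \notin U) && (b \in U) by case/andP: vU => _; rewrite ab.
apply/subsetP => -[x y] xyU; have [[-> ->] //|neq] := eqVneq (x, y) (a, b).
move: (xyU); rewrite in_clopen => /and5P[xy ax yb xU yU].
apply: small_pair_in => //; first exact: (subsetP cover).
apply: pair_rank_lt => //; last exact: trileW.
apply: contraTneq yU => <-; case/orP: xU => [/eqP->|xU]; first by rewrite negb_or ab.
by rewrite negb_or xU andbT; apply: contraNneq xU => ->.
Qed.

End AntisymmetricInterval.

(** * Join covers in a two-element component *)

Section DoubletonComponent.
Variables a c : E.
Hypotheses (ac : a != c) (ace : (a, c) \in e) (cae : (c, a) \in e).
Hypothesis above : forall z, trile e a z -> z = a \/ z = c.

(** No third point lies above [a], so the pair cannot arise by composition through a new point. *)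
Lemma doubleton_pair A B : (a, c) \in cl (val A :|: val B) ->
  (a, c) \in val A :|: val B.
Proof.
move=> /cl_split /(_ ac) [//|[z [za zc /cl_regU_e/trileW/above]]].
by case=> h; rewrite h eqxx in za zc.
Qed.

Lemma doubleton_clopen U : a \notin U -> c \in U -> clopen a c U = [set (a, c)].
Proof.
move=> aU cU; apply/setP => -[x y]; rewrite in_clopen inE xpair_eqE; apply/idP/idP.
  case/and5P=> xy ax _; have ay := trileW (trile_in ax xy).
  case: (above ax) => -> ; last by rewrite eq_sym (negPf ac) cU.
  by case: (above ay) => ->; rewrite !eqxx // (negPf ac) (negPf aU).
by case/andP=> /eqP-> /eqP->; rewrite ace !trile_refl !eqxx.
Qed.

(** The singleton of [(a, c)] is a clopen set, ranked below the loop thanks to the extra unit in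
    [pair_rank]. *)
Lemma doubleton_small A Z :
    (forall s, valid_index s -> (index_rank s < pair_rank a a)%N ->
       reg_clopen s <= A -> reg_clopen s <= Z) ->
  (a, c) \in val A -> (a, c) \in val Z.
Proof.
have clopen_ac : clopen a c [set c] = [set (a, c)].
  by apply: doubleton_clopen; rewrite inE.
move=> small acA; have := small (a, c, [set c]).
rewrite /valid_index /= ace ac !inE ac eqxx !reg_leE /= clopen_ac !sub1set; apply=> //.
rewrite /index_rank /pair_rank /= eqxx (negPf ac) addn0 addn1 ltnS subset_leq_card //.
exact: itvS (trile_refl _) (trileW cae).
Qed.

Lemma loop_split G : (a, a) \in cl G -> cl G \subset e ->
  (a, a) \in G \/ (a, c) \in cl G /\ (c, a) \in cl G.
Proof.
move=> aaG Ge.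
suff h x y : (x, y) \in cl G -> x = a -> y = a ->
  (a, a) \in G \/ (a, c) \in cl G /\ (c, a) \in cl G by apply: (h a a).
move: x y; apply: cl_ind => [x y xyG xa ya|y x z xy yz IHxy IHyz xa za].
  by left; rewrite -{1}xa -ya.
have : trile e a y by apply: trileW; rewrite -xa; apply: (subsetP Ge).
case/above => y_eq; first exact: IHxy.
by right; rewrite -y_eq -{1}xa -za.
Qed.

Lemma loop_reg D : (a, a) \in val D -> (a, c) \in val D \/ (c, a) \in val D.
Proof.
have opD := int_open (val D) te; have /andP[De _] := valP D.
rewrite {1}(reg_cl_int D) => /loop_split[]; first by rewrite -reg_cl_int.
  move=> /(open_split opD) /(_ ace cae).
  by case=> /(subsetP (int_sub _ _)); [left|right].
by rewrite -reg_cl_int => -[? _]; left.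
Qed.

End DoubletonComponent.

(** It suffices that [(a, c)] and [(c, a)] both lie in the union of [A] and [B]: rank then puts them
    in [Z], and transitivity gives the loop. One of them is in the clopen set, according to whether
    [c] is in [U]. If the loop lies in [A] or in [B], that member contains one of the two pairs,
    which must be the other one, as it does not contain the whole clopen set. *)
Lemma doubleton_cover a c U A B Z : a != c -> (a, c) \in e -> (c, a) \in e ->
    (forall z, trile e a z -> z = a \/ z = c) ->
    clopen a a U \subset cl (val A :|: val B) ->
    ~~ (clopen a a U \subset val A) -> ~~ (clopen a a U \subset val B) ->
    (forall s, valid_index s -> (index_rank s < pair_rank a a)%N ->
       (reg_clopen s <= A) || (reg_clopen s <= B) -> reg_clopen s <= Z) ->
  clopen a a U \subset val Z.
Proof.
move=> ac ace cae above cover nA nB small.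
have ca : c != a by rewrite eq_sym.
have aae := e_trans ace cae.
have above_c z : trile e c z -> z = c \/ z = a.
  by move=> cz; case: (above z) => [|->|->]; [exact: trile_trans (trileW ace) cz | right | left].
have sub_pairs D : (a, a) \in val D -> (c \in U -> (a, c) \in val D) ->
    (c \notin U -> (c, a) \in val D) -> clopen a a U \subset val D.
  move=> aaD acD caD; apply/subsetP => -[x y]; rewrite in_clopen => /and5P[xy ax ya].
  case: (above _ ax) => ->; case: (above _ (trileW (trile_in ax xy))) => -> //.
  - by rewrite (negPf ca) /= => _ /acD.
  - by rewrite (negPf ca) /= => /caD.
  - by rewrite (negPf ca) /= => /negPf ->.
have pair_cl x y : (x, y) \in clopen a a U -> (x, y) \in cl (val A :|: val B).
  exact: (subsetP cover).
have both : (a, c) \in val A :|: val B /\ (c, a) \in val A :|: val B.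
  have acU : c \in U -> (a, c) \in val A :|: val B.
    move=> cU; apply: doubleton_pair => //; apply: pair_cl.
    by rewrite in_clopen ace trile_refl trileW // eqxx cU orbT.
  have caU : c \notin U -> (c, a) \in val A :|: val B.
    move=> cU; apply: doubleton_pair => //; apply: pair_cl.
    by rewrite in_clopen cae trile_refl trileW // eqxx cU orbT.
  have clAB_e : cl (val A :|: val B) \subset e.
    by apply/subsetP => -[x y]; apply: cl_regU_e.
  have aa_cl := pair_cl a a (mem_clopen U aae).
  case: (loop_split above aa_cl clAB_e) => [|[acl cal]]; last by split; apply: doubleton_pair.
  have via D : val D \subset val A :|: val B -> ~~ (clopen a a U \subset val D) ->
      (a, a) \in val D -> (a, c) \in val A :|: val B /\ (c, a) \in val A :|: val B.
    move=> /subsetP DAB nD aaD; have := loop_reg ace cae above aaD.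
    have [cU|cU] := boolP (c \in U).
      case=> acD; first by case/negP: nD; apply: sub_pairs => //; rewrite cU.
      by split; [exact: acU | exact: DAB].
    case=> caD; last by case/negP: nD; apply: sub_pairs => //; rewrite (negPf cU).
    by split; [exact: DAB | exact: caU].
  by case/setUP; apply: via => //; rewrite ?subsetUl ?subsetUr.
have smallA s : valid_index s -> (index_rank s < pair_rank a a)%N ->
    reg_clopen s <= A -> reg_clopen s <= Z.
  by move=> vs lt_s sA; apply: small => //; rewrite sA.
have smallB s : valid_index s -> (index_rank s < pair_rank a a)%N ->
    reg_clopen s <= B -> reg_clopen s <= Z.
  by move=> vs lt_s sB; apply: small => //; rewrite sB orbT.
(* This permits [doubleton_small] with [a] and [c] exchanged. *)
have rank_c : pair_rank c c = pair_rank a a.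
  rewrite /pair_rank !eqxx; congr (#|pred_of_set _| + _)%N.
  by apply/eqP; rewrite eqEsubset !itvS ?trileW.
have [acAB caAB] := both.
have acZ : (a, c) \in val Z.
  by case/setUP: acAB; apply: doubleton_small.
have caZ : (c, a) \in val Z.
  by case/setUP: caAB; apply: doubleton_small; rewrite ?rank_c.
by apply: sub_pairs => //; apply: reg_trans acZ caZ.
Qed.

(** * From components to bounded images *)

Definition component_condition : Prop :=
  forall C : {set E}, C \in components e ->
    set_antisymmetric (restriction e C) \/
    exists a b : E, [/\ C = [set a; b], a <> b, (a, b) \in e & (b, a) \in e].

Lemma component_trile a x : trile e a x || trile e x a -> x \in component e a.
Proof. by move=> ax; rewrite inE; apply: connect1. Qed.

Lemma component_local a b : component_condition -> (a, b) \in e ->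
  itv_antisymmetric a b \/
  exists c, [/\ a != c, (a, c) \in e, (c, a) \in e
              & forall z, trile e a z -> z = a \/ z = c].
Proof.
move=> iv abe.
have inC z : trile e a z -> z \in component e a.
  by move=> az; apply: component_trile; rewrite az.
case: (iv (component e a) (imset_f _ _)) => // [anti|[x [y [C_eq xy xye yxe]]]].
  left=> x y ax xy yx xb; have [//|neq] := eqVneq x y.
  have [xC yC] := (inC _ ax, inC _ (trile_trans ax xy)).
  by apply: anti; rewrite in_setI in_setX /= ?xC ?yC trile_neq // eq_sym.
right; have : a \in [set x; y] by rewrite -C_eq inC ?trile_refl.
have {}inC z : trile e a z -> z = x \/ z = y.
  by move/inC; rewrite C_eq !inE => /orP[] /eqP; [left|right].
rewrite !inE => /orP[] /eqP a_eq; [exists y | exists x]; rewrite a_eq in inC *; split=> //.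
- exact/eqP.
- by apply/eqP/nesym.
- by move=> z /inC[]; [right | left].
Qed.

Lemma clopen_ranked : component_condition ->
  ranked_join_generators valid_index reg_clopen index_rank.
Proof.
move=> iv; split=> [|[[a b] U] A B vU]; first exact: clopen_join_dense.
rewrite !reg_leE /= => cover nA nB Z small.
have abe : (a, b) \in e by case/andP: vU.
have [anti|[c [ac ace cae above]]] := component_local iv abe.
  exact: (@antisymmetric_cover _ _ anti U vU A B).
case: (above b (trileW abe)) => b_eq; rewrite b_eq in vU cover nA nB small *.
  exact: (@doubleton_cover a c U A B).
(* For [b = c] the clopen set is a single pair, already in [A] or [B], so it has no nontrivial
   cover. *)
move: vU; rewrite /valid_index /= ac /= => /and3P[_ aU cU].
rewrite (doubleton_clopen ac ace above aU cU) !sub1set in cover nA nB *.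
by have := doubleton_pair ac above cover; rewrite inE (negPf nA) (negPf nB).
Qed.

(** * The orthocomplementation of the lattice of regular closed sets *)

Lemma open_setD G : set_transitive G -> G \subset e -> is_open e (e :\: G).
Proof. by move=> tG Ge; rewrite /is_open subsetDl setDDr setDv set0U (setIidPr Ge). Qed.

(** Closure and interior are exchanged by complementation in [e]; this makes [reg_compl] an
    involution. *)
Lemma interiorE A : interior e (val A) = e :\: cl (e :\: val A).
Proof.
have /andP[Ae _] := valP A; have /andP[_ tA] := int_open (val A) te.
apply/eqP; rewrite eqEsubset; apply/andP; split.
  have clD : cl (e :\: val A) \subset e :\: interior e (val A).
    by apply: cl_sub => //; apply: setDS; apply: int_sub.
  rewrite subsetD (subset_trans (int_sub _ _) Ae) disjoint_sym.
  by move: clD; rewrite subsetD => /andP[].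
apply: sub_int.
  by apply: open_setD; [exact: cl_transitive | apply: cl_sub => //; apply: subsetDl].
apply/subsetP => p; rewrite inE => /andP[+ pe]; apply: contraR => pA.
by apply: (subsetP (sub_cl _)); rewrite inE pA.
Qed.

Definition reg_compl A : Reg te :=
  Sub (cl (interior e (e :\: val A))) (cl_int_regular (e :\: val A) te).

Lemma val_reg_compl A : val (reg_compl A) = cl (e :\: val A).
Proof.
rewrite /= int_id // open_setD //; first exact: regular_closed_trans (valP A).
by case/andP: (valP A).
Qed.

Lemma reg_complK : involutive reg_compl.
Proof.
move=> A; apply: val_inj; rewrite !val_reg_compl -interiorE; apply/esym.
exact: reg_cl_int.
Qed.

Lemma reg_compl_le : {mono reg_compl : A B / A <= B >-> B <= A}.
Proof.
have anti A B : A <= B -> reg_compl B <= reg_compl A.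
  by rewrite !reg_leE !val_reg_compl => AB; apply/clS/setDS.
by move=> A B; apply/idP/idP => /anti //; rewrite !reg_complK.
Qed.

Lemma component_bounded_image : component_condition ->
  bounded_image_of_free (Reg te).
Proof.
by move=> /clopen_ranked; apply: ranked_bounded_image reg_complK reg_compl_le.
Qed.

(** * From pseudocomplements to components *)

(** The meet is the closure of an open set, so disjointness can be tested on open sets, where
    [open_split] is available. *)
Lemma meet_eq_bot A B :
    (forall O x y, is_open e O -> (x, y) \in O -> O \subset val A ->
       O \subset val B -> False) ->
  A `&` B = \bot.
Proof.
move=> AB; apply: val_inj => /=.
have -> : interior e (val A :&: val B) = set0; last first.
  by rewrite cl_id //; apply: regular_closed_trans (regular0 te).
apply/setP => -[x y]; rewrite inE; apply/negP => xy.
apply: (AB _ x y (int_open _ te) xy).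
  exact: subset_trans (int_sub _ _) (subsetIl _ _).
exact: subset_trans (int_sub _ _) (subsetIr _ _).
Qed.

(** Both [B] and [D] lie below the pseudocomplement of [A], hence so does [A]. *)
Lemma pseudocomplemented_disjoint_join A B D : pseudocomplemented (Reg te) ->
  A `&` B = \bot -> A `&` D = \bot -> A <= B `|` D -> A = \bot.
Proof.
move=> pc AB AD ABD; have [m [Am m_max]] := pc A.
rewrite -Am; apply/esym/meet_idPl/(le_trans ABD).
by rewrite leUx !m_max.
Qed.

(** The pairs of [A] start at [x] or [y] and end elsewhere; [B] covers those starting at [x], [D]
    those starting at [y]. An open set inside [A] and [B] with a pair [(x, v)] would contain
    [(x, y)], absent from [A], or [(y, v)], absent from [B]; likewise for [D]. Yet [A] contains
    [(x, z)]. *)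
Lemma no_element_above x y z : pseudocomplemented (Reg te) ->
  x != y -> (x, y) \in e -> (y, x) \in e -> z != x -> z != y -> (x, z) \notin e.
Proof.
move=> pc xy xye yxe zx zy; apply/negP => xze; have yze := e_trans yxe xze.
pose A := reg_clopen (x, z, ~: [set x; y]).
pose B := reg_clopen (x, z, ~: [set x]).
pose D := reg_clopen (y, z, ~: [set y]).
have inA u v : (u, v) \in val A -> [&& (u == x) || (u == y), v != x & v != y].
  rewrite in_clopen !inE !negbK => /and5P[_ _ _ uU vU].
  apply/andP; split; first by case/or3P: uU => ->; rewrite ?orbT.
  by case/orP: vU => [/eqP->|]; [rewrite zx zy | rewrite negb_or].
have inB u v : (u, v) \in val B -> u = x.
  by rewrite in_clopen !inE negbK orbb => /and5P[_ _ _ /eqP].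
have inD u v : (u, v) \in val D -> u = y.
  by rewrite in_clopen !inE negbK orbb => /and5P[_ _ _ /eqP].
have : A = \bot.
  apply: (@pseudocomplemented_disjoint_join A B D) => //.
  - apply: meet_eq_bot => O u v opO uvO /subsetP OA /subsetP OB.
    have ux := inB _ _ (OB _ uvO); rewrite {u}ux in uvO.
    have xve := reg_e (OA _ uvO).
    have [/OA/inA|/OB/inB yx] := open_split opO uvO xye (e_trans yxe xve).
      by rewrite (eqxx y) /= !andbF.
    by rewrite yx eqxx in xy.
  - apply: meet_eq_bot => O u v opO uvO /subsetP OA /subsetP OD.
    have uy := inD _ _ (OD _ uvO); rewrite {u}uy in uvO.
    have yve := reg_e (OA _ uvO).
    have [/OA/inA|/OD/inD yx] := open_split opO uvO yxe (e_trans xye yve).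
      by rewrite (eqxx x) /= andbF.
    by rewrite yx eqxx in xy.
  - rewrite reg_leE; apply: subset_trans (sub_cl _).
    apply/subsetP => -[u v] uvA; have /and3P[uxy vx vy] := inA _ _ uvA.
    move: uvA; rewrite in_setU !in_clopen !inE /= => /and5P[-> _ -> _ _].
    by case/orP: uxy => /eqP->; rewrite trile_refl eqxx ?vx ?vy !orbT.
move/(congr1 val) => /= A0; have := mem_clopen (~: [set x; y]) xze.
by rewrite A0 inE.
Qed.

(** The order dual of the preceding argument: pairs are sorted by their target instead of their
    source. *)
Lemma no_element_below x y z : pseudocomplemented (Reg te) ->
  x != y -> (x, y) \in e -> (y, x) \in e -> z != x -> z != y -> (z, x) \notin e.
Proof.
move=> pc xy xye yxe zx zy; apply/negP => zxe; have zye := e_trans zxe xye.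
pose A := reg_clopen (z, x, [set x; y]).
pose B := reg_clopen (z, x, [set x]).
pose D := reg_clopen (z, y, [set y]).
have inA u v : (u, v) \in val A -> [&& u != x, u != y & (v == x) || (v == y)].
  rewrite in_clopen !inE => /and5P[_ _ _ uU vU].
  rewrite andbA; apply/andP; split; last by case/or3P: vU => ->; rewrite ?orbT.
  by case/orP: uU => [/eqP->|]; [rewrite zx zy | rewrite negb_or].
have inB u v : (u, v) \in val B -> v = x.
  by rewrite in_clopen !inE orbb => /and5P[_ _ _ _ /eqP].
have inD u v : (u, v) \in val D -> v = y.
  by rewrite in_clopen !inE orbb => /and5P[_ _ _ _ /eqP].
have : A = \bot.
  apply: (@pseudocomplemented_disjoint_join A B D) => //.
  - apply: meet_eq_bot => O u v opO uvO /subsetP OA /subsetP OB.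
    have vx := inB _ _ (OB _ uvO); rewrite {v}vx in uvO.
    have uxe := reg_e (OA _ uvO).
    have [/OB/inB yx|/OA/inA] := open_split opO uvO (e_trans uxe xye) yxe.
      by rewrite yx eqxx in xy.
    by rewrite (eqxx y) /= andbF.
  - apply: meet_eq_bot => O u v opO uvO /subsetP OA /subsetP OD.
    have vy := inD _ _ (OD _ uvO); rewrite {v}vy in uvO.
    have uye := reg_e (OA _ uvO).
    have [/OD/inD yx|/OA/inA] := open_split opO uvO (e_trans uye yxe) xye.
      by rewrite yx eqxx in xy.
    by rewrite (eqxx x).
  - rewrite reg_leE; apply: subset_trans (sub_cl _).
    apply/subsetP => -[u v] uvA; have /and3P[ux uy vxy] := inA _ _ uvA.
    move: uvA; rewrite in_setU !in_clopen !inE /= => /and5P[-> -> _ _ _].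
    by case/orP: vxy => /eqP->; rewrite trile_refl eqxx ?ux ?uy !orbT.
move/(congr1 val) => /= A0; have := mem_clopen [set x; y] zxe.
by rewrite A0 inE.
Qed.

Lemma pseudocomplemented_component :
  pseudocomplemented (Reg te) -> component_condition.
Proof.
move=> pc C /imsetP[x0 _ C_eq].
have [anti|/existsNP[x /existsNP[y]]] := pselect (set_antisymmetric (restriction e C)).
  by left.
move=> /not_implyP[+ /not_implyP[+ /eqP xy]].
rewrite !in_setI !in_setX /= => /and3P[xye xC yC] /andP[yxe _].
right; exists x, y; split=> //; last exact/eqP.
pose R := [rel u v | trile e u v || trile e v u].
have R_sym : symmetric R by move=> u v; rewrite /R /= orbC.
(* No third element is comparable to [x] or [y], so the doubleton is closed under adjacency and
   absorbs every walk from [x]. *)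
have stay u v : u \in [set x; y] -> R u v -> v \in [set x; y].
  have stay_x s t w : s != t -> (s, t) \in e -> (t, s) \in e -> R s w -> (w == s) || (w == t).
    move=> st ste tse; have [//|ws] := eqVneq w s; have [//|wt] := eqVneq w t.
    case/orP=> /trile_neq.
      by rewrite eq_sym ws (negPf (no_element_above pc st ste tse ws wt)) => /(_ isT).
    by rewrite ws (negPf (no_element_below pc st ste tse ws wt)) => /(_ isT).
  move=> /set2P u_eq uv.
  rewrite !inE; case: u_eq uv => -> uv; first exact: stay_x uv.
  by rewrite orbC; apply: stay_x uv => //; rewrite eq_sym.
apply/eqP; rewrite eqEsubset subUset !sub1set xC yC !andbT.
apply/subsetP => z zC; have x0x := xC; have x0z := zC.
rewrite C_eq inE -/R in x0x; rewrite C_eq inE -/R in x0z.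
have : connect R x z by apply: connect_trans x0z; rewrite (sym_connect_sym R_sym).
have walk p u : u \in [set x; y] -> path R u p -> last u p \in [set x; y].
  by elim: p u => //= v p IHp u uxy /andP[/(stay _ _ uxy)]; apply: IHp.
by case/connectP=> p xp ->; apply: walk => //; rewrite !inE eqxx.
Qed.

End RegularClosed.

Theorem theorem7p8 (E : finType) (e : {set E * E}) (te : set_transitive e) :
  [<-> bounded_image_of_free (Reg te);
       semidistributive (Reg te);
       pseudocomplemented (Reg te);
       forall C : {set E}, C \in components e ->
         set_antisymmetric (restriction e C) \/
         exists a b : E,
           [/\ C = [set a; b], a <> b, (a, b) \in e & (b, a) \in e]].
Proof.
tfae.
- exact: bounded_image_semidistributive.
- by case=> _; apply: semidistributive_pseudocomplemented.
- exact: pseudocomplemented_component.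
- exact: component_bounded_image.
Qed.
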